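(* Let $\mathcal{R}$ be a constructor TRS that is well-typed with respect to an annotated signature $\mathcal{F}$, and let $\gamma$ be the interpretation of function symbols induced by $\mathcal{F}$. Then $l>r$ for every rule $l\to r\in\mathcal{R}$. Consequently, if $[t:A]\in O(n^k)$ for all ground basic terms $t$ and annotated types $A$, where $n=|t|$, then $\mathrm{rc}_{\mathcal{R}}(n)\in O(n^k)$.
   Context: Typed rewriting. $\mathcal{C}$ (constructors) and $\mathcal{D}$ (defined symbols) are disjoint finite sets of function symbols, $S$ a finite set of base types, $\mathcal{V}$ an $S$-sorted set of variables. Every $f\in\mathcal{C}\cup\mathcal{D}$ has a base type declaration $A_1\times\cdots\times A_n\to C$; terms respect declarations. Values are ground constructor terms. Substitutions respect types and are normalised (range consists of values). $\mathcal{R}$ is a finite set of typed rules $f(l_1,\dots,l_n)\to r$ with $f\in\mathcal{D}$, $l_i$ built from constructors and variables, $l,r$ of the same type, $\mathrm{Var}(r)\subseteq\mathrm{Var}(l)$; $\mathcal{R}$ is left-linear, non-overlapping and completely defined (every ground normal form is a value). Innermost rewriting: $s\to t$ iff $s=C[l\sigma]$, $t=C[r\sigma]$ for a rule $l\to r$, a context $C$ and a normalised $\sigma$. $\mathrm{dh}(t,\to)$ is the maximal length of a $\to$-derivation from $t$; $|t|$ is the number of symbols of $t$. A term $f(t_1,\dots,t_k)$ is basic if $f\in\mathcal{D}$ and each $t_i$ is built from constructors and variables; $\mathrm{rc}_{\mathcal{R}}(n)=\max\{\mathrm{dh}(t,\to): t \text{ basic}, |t|\leqslant n\}$. Annotated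 types. A resource annotation is a finite vector of natural numbers (more generally non-negative rationals; here the interpretations are over $\mathbb{N}$); $\leqslant$ and $+$ are componentwise after padding with zeros. An annotated type $A^{\vec p}$ is a base type with an annotation. An annotated signature $\mathcal{F}$ maps each $f$ with base declaration $A_1\times\cdots\times A_n\to C$ to a nonempty set of annotated declarations $A_1^{\vec u_1}\times\cdots\times A_n^{\vec u_n}\xrightarrow{p}C^{\vec v}$ (cost $p\in\mathbb{N}$), with exactly one declaration for each result annotation $\vec v$, and for constructors closed under scaling by $\lambda\geqslant0$ and componentwise addition. Sharing $A^{\vec p}\curlyvee(A_1^{\vec p_1},A_2^{\vec p_2})$ iff $A=A_1=A_2$, $\vec p_1+\vec p_2=\vec p$; subtyping $A^{\vec p}<:B^{\vec q}$ iff $A=B$, $\vec p\geqslant\vec q$. Type system. Typing contexts map finitely many variables to annotated types; $\Gamma\vdash^{p}t:C$ is derived by: (1) if $A_1\times\cdots\times A_n\xrightarrow{p}C\in\mathcal{F}(f)$ then $x_1:A_1,\dots,x_n:A_n\vdash^{p}f(x_1,\dots,x_n):C$; (2) from $\Gamma\vdash^{p}t:C$, $p'\geqslant p$ infer $\Gamma\vdash^{p'}t:C$; (3) if $x_i$ fresh, $x_1:A_1,\dots,x_n:A_n\vdash^{p_0}f(x_1,\dots,x_n):C$, $\Gamma_i\vdash^{p_i}t_i:A_i$, $p=\sum_{i=0}^np_i$, then $\Gamma_1,\dots,\Gamma_n\vdash^{p}f(t_1,\dots,t_n):C$; (4) from $\Gamma\vdash^{p}t:C$ infer $\Gamma,x:A\vdash^{p}t:C$;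 (5) from $\Gamma,x:A_1,y:A_2\vdash^{p}t[x,y]:C$, $A\curlyvee(A_1,A_2)$, $x,y$ fresh, infer $\Gamma,z:A\vdash^{p}t[z,z]:C$; (6) from $\Gamma,x:B\vdash^{p}t:C$, $A<:B$ infer $\Gamma,x:A\vdash^{p}t:C$; (7) $x:A\vdash^{0}x:A$; (8) from $\Gamma\vdash^{p}t:D$, $D<:C$ infer $\Gamma\vdash^{p}t:C$. $\mathcal{R}$ is well-typed if for every rule $f(l_1,\dots,l_n)\to r$ with $\mathrm{Var}(f(l_1,\dots,l_n))=\{y_1,\dots,y_\ell\}$, every $A_1\times\cdots\times A_n\xrightarrow{p}C\in\mathcal{F}(f)$, all annotated $B_1,\dots,B_\ell$ and costs $k_i$ with $y_1:B_1,\dots,y_\ell:B_\ell\vdash^{k_i}l_i:A_i$ derivable, $y_1:B_1,\dots,y_\ell:B_\ell\vdash^{p-1+\sum_ik_i}r:C$ is derivable. Interpretation. The interpretation induced by $\mathcal{F}$ assigns to each function symbol $f$ and annotated type $C$ with $A_1\times\cdots\times A_n\xrightarrow{p}C\in\mathcal{F}(f)$ the function $\gamma(f,C)(x_1,\dots,x_n)=x_1+\cdots+x_n+p$ over $\mathbb{N}$. For ground terms, $[f(t_1,\dots,t_n):C]=\gamma(f,C)([t_1:A_1],\dots,[t_n:A_n])$ with $A_i$ taken from that unique declaration. For terms $s,t$ of the same type and an annotated type $A$ of that type, $s>t$ means $[s\sigma:A]>[t\sigma:A]$ for all well-typed (normalised, ground) substitutions $\sigma$; for a rule this is required for every annotated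 type $A$ occurring as a result type in $\mathcal{F}$ of the root symbol of the left-hand side.
   Formalization: The claim l>r is proved assuming that, for defined symbols, a smaller result annotation has componentwise smaller argument annotations and cost; without this, result subtyping (rule 8) makes it false. The complexity consequence is proved without this assumption. *)

(* Defs.v *)
From Stdlib Require List.
From mathcomp Require Import all_boot.

Set Implicit Arguments.
Unset Strict Implicit.
Unset Printing Implicit Defensive.

(** * Sorted terms *)

(* [defined] carves the defined symbols out of the finite set of function
   symbols; the remaining symbols are the constructors. *)
Record signature := Signature {
  bsort : finType;
  fsym : finType;
  defined : pred fsym;
  arg_sorts : fsym -> seq bsort;
  res_sort : fsym -> bsort }.

(* Countably many variables of each sort. *)
Definition var (S : signature) : Type := (bsort S * nat)%type.

Definition vsort (S : signature) (x : var S) : bsort S := x.1.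

Inductive term (S : signature) : Type :=
  | Var of var S
  | App of fsym S & seq (term S).
Arguments Var {S} x.
Arguments App {S} f ts.

Definition is_var (S : signature) (t : term S) : bool :=
  if t is Var _ then true else false.

Definition sort_of (S : signature) (t : term S) : bsort S :=
  match t with Var x => vsort x | App f _ => res_sort f end.

Fixpoint wf_term (S : signature) (t : term S) : bool :=
  match t with
  | Var _ => true
  | App f ts => (map (@sort_of S) ts == arg_sorts f) && all (@wf_term S) ts
  end.

Fixpoint vars (S : signature) (t : term S) : seq (var S) :=
  match t with
  | Var x => [:: x]
  | App _ ts => flatten (map (@vars S) ts)
  end.

Fixpoint tsize (S : signature) (t : term S) : nat :=
  match t with
  | Var _ => 1
  | App _ ts => (sumn (map (@tsize S) ts)).+1
  end.

Definition ground (S : signature) (t : term S) : bool := nilp (vars t).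

Fixpoint cterm (S : signature) (t : term S) : bool :=
  match t with
  | Var _ => true
  | App f ts => ~~ defined f && all (@cterm S) ts
  end.

Definition value (S : signature) (t : term S) : bool := ground t && cterm t.

Definition basic (S : signature) (t : term S) : bool :=
  match t with
  | Var _ => false
  | App f ts => defined f && all (@cterm S) ts
  end.

Fixpoint subst (S : signature) (s : var S -> term S) (t : term S) : term S :=
  match t with
  | Var x => s x
  | App f ts => App f (map (subst s) ts)
  end.

Definition wf_subst (S : signature) (s : var S -> term S) : Prop :=
  forall x, wf_term (s x) /\ sort_of (s x) = vsort x.

(* A normalised substitution with domain [X]: only its values on [X] matter, so
   that sorts without values are harmless. *)
Definition normalised_on (S : signature) (X : seq (var S))
    (s : var S -> term S) : Prop :=
  forall x, x \in X ->
    [/\ wf_term (s x), sort_of (s x) = vsort x & value (s x)].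

Inductive context (S : signature) : Type :=
  | Hole
  | CApp of fsym S & seq (term S) & context S & seq (term S).
Arguments Hole {S}.

Fixpoint plug (S : signature) (C : context S) (t : term S) : term S :=
  match C with
  | Hole => t
  | CApp f pre C' post => App f (pre ++ plug C' t :: post)
  end.

(** * Term rewrite systems *)

Definition trs (S : signature) : Type := seq (term S * term S).

Definition rule_ok (S : signature) (l r : term S) : Prop :=
  [/\ basic l, wf_term l, wf_term r, sort_of l = sort_of r
    & {subset vars r <= vars l}].

Definition left_linear (S : signature) (R : trs S) : Prop :=
  forall l r, List.In (l, r) R -> uniq (vars l).

Definition variant (S : signature) (l1 r1 l2 r2 : term S) : Prop :=
  exists ren : var S -> var S,
    [/\ bijective ren, forall x, vsort (ren x) = vsort x,
        l2 = subst (Var \o ren) l1 & r2 = subst (Var \o ren) r1].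

(* Using two independent substitutions amounts to renaming the rules apart. *)
Definition non_overlapping (S : signature) (R : trs S) : Prop :=
  forall l1 r1 l2 r2 C u s1 s2,
    List.In (l1, r1) R -> List.In (l2, r2) R ->
    l1 = plug C u -> ~~ is_var u ->
    wf_subst s1 -> wf_subst s2 -> subst s1 u = subst s2 l2 ->
    C = Hole /\ variant l1 r1 l2 r2.

Definition step (S : signature) (R : trs S) (t u : term S) : Prop :=
  exists (C : context S) (l r : term S) (s : var S -> term S),
    [/\ List.In (l, r) R, normalised_on (vars l) s,
        t = plug C (subst s l) & u = plug C (subst s r)].

Definition completely_defined (S : signature) (R : trs S) : Prop :=
  forall t : term S, wf_term t -> ground t ->
    (forall u, ~ step R t u) -> value t.

Record constructor_trs (S : signature) (R : trs S) : Prop := ConstructorTRS {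
  trs_rules : forall l r, List.In (l, r) R -> rule_ok l r;
  trs_left_linear : left_linear R;
  trs_non_overlapping : non_overlapping R;
  trs_completely_defined : completely_defined R }.

Inductive derivation (S : signature) (R : trs S) : nat -> term S -> Prop :=
  | deriv0 t : derivation R 0 t
  | derivS m t u : step R t u -> derivation R m u -> derivation R m.+1 t.

(* [is_dh R t d] : the derivation height of [t] exists and equals [d]. *)
Definition is_dh (S : signature) (R : trs S) (t : term S) (d : nat) : Prop :=
  derivation R d t /\ forall m, derivation R m t -> m <= d.

Definition small_basic (S : signature) (n : nat) (t : term S) : Prop :=
  [/\ wf_term t, basic t & tsize t <= n].

(* [is_rc R n m] : every basic term of size at most [n] has a derivation height
   and [m] is the maximum of these heights (0 if there is no such term). *)
Definition is_rc (S : signature) (R : trs S) (n m : nat) : Prop :=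
  [/\ forall t : term S, small_basic n t -> exists2 d, is_dh R t d & d <= m
    & (exists2 t : term S, small_basic n t & is_dh R t m) \/
      ((forall t : term S, ~ small_basic n t) /\ m = 0)].

Definition bigO (f : nat -> nat) (k : nat) : Prop :=
  exists c n0, forall n, n0 <= n -> f n <= c * n ^ k.

(** * Annotated types *)

(* Finite vectors; every comparison and operation pads with zeros. *)
Definition annot : Type := seq nat.

Definition ann_eq (u v : annot) : Prop := forall i, nth 0 u i = nth 0 v i.
Definition ann_le (u v : annot) : Prop := forall i, nth 0 u i <= nth 0 v i.
Definition ann_add (u v : annot) : annot :=
  mkseq (fun i => nth 0 u i + nth 0 v i) (maxn (size u) (size v)).
Definition ann_scale (c : nat) (u : annot) : annot := map (muln c) u.

Definition atype (S : signature) : Type := (bsort S * annot)%type.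

Definition sharing (S : signature) (A A1 A2 : atype S) : Prop :=
  [/\ A.1 = A1.1, A.1 = A2.1 & ann_eq (ann_add A1.2 A2.2) A.2].

Definition subtype (S : signature) (A B : atype S) : Prop :=
  A.1 = B.1 /\ ann_le B.2 A.2.

(* The argument annotations and the cost of an annotated declaration; its base
   types are those of the symbol it belongs to. *)
Record decl := Decl { dargs : seq annot; dcost : nat }.

Definition decl_eq (d e : decl) : Prop :=
  [/\ size (dargs d) = size (dargs e),
      forall i, ann_eq (nth [::] (dargs d) i) (nth [::] (dargs e) i)
    & dcost d = dcost e].

Definition decl_add (d e : decl) : decl :=
  Decl [seq ann_add uv.1 uv.2 | uv <- zip (dargs d) (dargs e)]
       (dcost d + dcost e).

Definition decl_scale (c : nat) (d : decl) : decl :=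
  Decl (map (ann_scale c) (dargs d)) (c * dcost d).

(* A symbol has exactly one declaration for each result annotation, so the set
   F(f) is given by the function mapping a result annotation [v] to the
   declaration in F(f) with result annotation [v]. *)
Definition asig (S : signature) : Type := fsym S -> annot -> decl.

Definition arg_types (S : signature) (F : asig S) (f : fsym S) (v : annot) :
    seq (atype S) :=
  zip (arg_sorts f) (dargs (F f v)).

Record annotated_signature (S : signature) (F : asig S) : Prop :=
  AnnotatedSignature {
    asig_arity : forall f v, size (dargs (F f v)) = size (arg_sorts f);
    asig_scale : forall f v c, ~~ defined f ->
      decl_eq (F f (ann_scale c v)) (decl_scale c (F f v));
    asig_add : forall f v w, ~~ defined f ->
      decl_eq (F f (ann_add v w)) (decl_add (F f v) (F f w)) }.

(* Result subtyping may type f(..) at annotation [v] through the declaration at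
   some [w] above [v], whereas the interpretation always uses the one at [v];
   this condition says that the latter is at least as cheap. For constructors it
   follows from closure under addition. *)
Definition subtype_monotone (S : signature) (F : asig S) : Prop :=
  forall f v w, defined f -> ann_le v w ->
    (forall i, ann_le (nth [::] (dargs (F f v)) i)
                      (nth [::] (dargs (F f w)) i)) /\
    dcost (F f v) <= dcost (F f w).

(** * Type system *)

(* Finite maps as duplicate-free association lists, up to permutation. *)
Definition tctx (S : signature) : Type := seq (var S * atype S).

Definition dom (S : signature) (G : tctx S) : seq (var S) := unzip1 G.

Definition identify (S : signature) (x y z : var S) (t : term S) : term S :=
  subst (fun w => Var (if (w == x) || (w == y) then z else w)) t.

Inductive typing (S : signature) (F : asig S) :
    tctx S -> nat -> term S -> atype S -> Prop :=
  | ty_decl f xs v :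
      uniq xs -> map (@vsort S) xs = arg_sorts f ->
      typing F (zip xs (arg_types F f v)) (dcost (F f v))
        (App f (map Var xs)) (res_sort f, v)
  | ty_cost G p p' t C :
      typing F G p t C -> p <= p' -> typing F G p' t C
  | ty_comp f xs As C p0 Gs ps ts :
      size xs = size ts -> size As = size ts ->
      size Gs = size ts -> size ps = size ts ->
      uniq (xs ++ dom (flatten Gs)) ->
      typing F (zip xs As) p0 (App f (map Var xs)) C ->
      (forall i, i < size ts ->
        typing F (nth [::] Gs i) (nth 0 ps i) (nth (App f ts) ts i)
          (nth C As i)) ->
      typing F (flatten Gs) (p0 + sumn ps) (App f ts) C
  | ty_weak G x A p t C :
      x \notin dom G -> A.1 = vsort x ->
      typing F G p t C -> typing F ((x, A) :: G) p t C
  | ty_share G x y z A A1 A2 p t C :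
      uniq [:: x, y & dom G] -> z \notin dom G -> A.1 = vsort z ->
      sharing A A1 A2 ->
      typing F [:: (x, A1), (y, A2) & G] p t C ->
      typing F ((z, A) :: G) p (identify x y z t) C
  | ty_subl G x A B p t C :
      subtype A B ->
      typing F ((x, B) :: G) p t C -> typing F ((x, A) :: G) p t C
  | ty_var x A :
      A.1 = vsort x -> typing F [:: (x, A)] 0 (Var x) A
  | ty_subr G p t D C :
      typing F G p t D -> subtype D C -> typing F G p t C
  | ty_exch G G' p t C :
      perm_eq G G' -> typing F G p t C -> typing F G' p t C.

(* The required cost [p - 1 + sumn ks] is an integer; costs of derivable
   judgements are natural numbers, hence the equation for [q]. *)
Definition well_typed (S : signature) (F : asig S) (R : trs S) : Prop :=
  forall f ls r, List.In (App f ls, r) R ->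
  forall (v : annot) (G : tctx S) (ks : seq nat),
    dom G = undup (vars (App f ls)) -> size ks = size ls ->
    (forall i, i < size ls ->
      typing F G (nth 0 ks i) (nth r ls i)
        (nth (res_sort f, v) (arg_types F f v) i)) ->
    exists2 q, q.+1 = dcost (F f v) + sumn ks
             & typing F G q r (res_sort f, v).

(** * The induced interpretation *)

Definition gamma (S : signature) (F : asig S) (f : fsym S) (C : atype S)
    (xs : seq nat) : nat :=
  sumn xs + dcost (F f C.2).

(* Meaningful on ground terms only. *)
Fixpoint interp (S : signature) (F : asig S) (t : term S) : atype S -> nat :=
  match t with
  | Var _ => fun _ => 0
  | App f ts => fun C =>
      gamma F f C
        [seq mA.1 mA.2 | mA <- zip (map (interp F) ts) (arg_types F f C.2)]
  end.

Definition interp_gt (S : signature) (F : asig S) (A : atype S)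
    (t u : term S) : Prop :=
  forall s : var S -> term S, normalised_on (vars t ++ vars u) s ->
    interp F (subst s u) A < interp F (subst s t) A.

(* The implied constants may depend on the annotated type but not on [t]. *)
Definition interp_bigO (S : signature) (F : asig S) (k : nat) : Prop :=
  forall A : atype S, exists c n0, forall t : term S,
    wf_term t -> ground t -> basic t -> sort_of t = A.1 ->
    n0 <= tsize t -> interp F t A <= c * tsize t ^ k.

(* Main.v *)
Require Import Defs.
From Stdlib Require List.
From mathcomp Require Import all_boot.
From mathcomp Require Import boolp.
Import Defs.

Set Implicit Arguments.
Unset Strict Implicit.
Unset Printing Implicit Defensive.

(** Interpret a term at annotation [v] by the cheapest way of paying for it when
    every symbol may use any declaration whose result annotation is above the
    required one; this cost is monotone in [v] by construction and never exceeds
    the induced interpretation. On values it coincides with the interpretation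
    and is additive in the annotation, because constructor declarations are
    closed under addition. Hence typing is sound: if [G |-^p t : C], then the
    cost of [t s] at [C] is at most [p] plus the costs of the values [s x] at the
    types in [G], sharing being paid for by additivity.

    For an instance [f(l_1, .., l_n) s] of a rule, reading the declaration of [f]
    top-down through the linear patterns yields a context in which the [l_i] are
    typed with no potential lost. Well-typedness and soundness then make the cost
    of [r s] at least one smaller. So costs bound derivation heights, and when [F]
    is monotone the cost is the interpretation itself. A basic term with
    variables is irreducible, so it suffices to bound ground terms. *)

(** * Sums, sequences, maxima and term induction *)

Lemma sumn_nth (s : seq nat) : sumn s = \sum_(i < size s) nth 0 s i.
Proof. by rewrite sumnE (big_nth 0) big_mkord. Qed.

Lemma leq_sum_ord n (E : nat -> nat) i : i < n -> E i <= \sum_(j < n) E j.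
Proof.
by move=> lt_in; rewrite (bigD1 (Ordinal lt_in)) //= leq_addr.
Qed.

Lemma sum_flatten (T : Type) (E : T -> nat) (Gs : seq (seq T)) :
  \sum_(p <- flatten Gs) E p
    = \sum_(i < size Gs) \sum_(p <- nth [::] Gs i) E p.
Proof.
elim: Gs => [|G Gs IH] /=; first by rewrite big_nil big_ord0.
by rewrite big_cat IH big_ord_recl.
Qed.

Lemma mem_flatten_nth (T : eqType) (ss : seq (seq T)) i x :
  i < size ss -> x \in nth [::] ss i -> x \in flatten ss.
Proof.
move=> lt_i x_in; apply/flattenP.
by exists (nth [::] ss i) => //; apply: mem_nth.
Qed.

Lemma mem_zip_nth (T U : eqType) (x0 : T) (y0 : U) s t i b :
  uniq s -> size s = size t -> i < size s ->
  (nth x0 s i, b) \in zip s t -> b = nth y0 t i.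
Proof.
move=> uq szE lt_i /(nthP (x0, y0)) [j]; rewrite size_zip -szE minnn => lt_j.
rewrite nth_zip // => -[/eqP]; rewrite nth_uniq // => /eqP -> -> //.
Qed.

Lemma nth_cat_cons (T : Type) (x0 x y : T) s1 s2 i : i != size s1 ->
  nth x0 (s1 ++ x :: s2) i = nth x0 (s1 ++ y :: s2) i.
Proof.
rewrite !nth_cat; case: ltngtP => // lt_i _.
by rewrite -(subnSK lt_i).
Qed.

Lemma bounded_has_max (P : nat -> Prop) m0 M :
  P m0 -> (forall m, P m -> m <= M) ->
  exists2 m, P m & forall m', P m' -> m' <= m.
Proof.
move=> P0 ub.
have ex0 : exists m, `[< P m >] by exists m0; apply/asboolP.
have ubb m : `[< P m >] -> m <= M by move/asboolP; exact: ub.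
case: (ex_maxnP ex0 ubb) => m /asboolP Pm maxm.
by exists m => // m' Pm'; apply/maxm/asboolP.
Qed.

(** The generated principle gives no hypothesis for the arguments, since they lie inside a list.
    Here they are reached by index. *)
Lemma term_nth_ind (S : signature) (P : term S -> Prop) :
  (forall x, P (Var x)) ->
  (forall f ts, (forall t0 i, i < size ts -> P (nth t0 ts i)) -> P (App f ts)) ->
  forall t, P t.
Proof.
move=> PV PA; fix IH 1 => -[x|f ts]; first exact: PV.
apply: PA => t0; elim: ts => [|t ts IHts] i.
  (* Clearing [IH] keeps the closing tactic from applying it to a term that is not structurally
     smaller. *)
  by clear IH; rewrite ltn0.
by case: i => [|i] lt_i; [exact: IH | exact: (IHts i)].
Qed.

(** * Sorted terms *)

Section Terms.
Variable S : signature.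
Implicit Types (t u l r : term S) (s : var S -> term S) (f : fsym S).

Lemma wf_size f (ts : seq (term S)) :
  wf_term (App f ts) -> size ts = size (arg_sorts f).
Proof. by move=> /= /andP[/eqP<- _]; rewrite size_map. Qed.

Lemma all_nth (P : pred (term S)) ts t0 i :
  all P ts -> i < size ts -> P (nth t0 ts i).
Proof. by move/(all_nthP t0); apply. Qed.

Lemma wf_nth f (ts : seq (term S)) t0 i :
  wf_term (App f ts) -> i < size ts -> wf_term (nth t0 ts i).
Proof. by move=> /= /andP[_ /all_nth]; apply. Qed.

Lemma sort_nth f (ts : seq (term S)) t0 b0 i :
  wf_term (App f ts) -> i < size ts ->
  sort_of (nth t0 ts i) = nth b0 (arg_sorts f) i.
Proof. by move=> /= /andP[/eqP<- _] lt_i; rewrite (nth_map t0). Qed.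

Lemma vars_nth f (ts : seq (term S)) t0 i :
  i < size ts -> {subset vars (nth t0 ts i) <= vars (App f ts)}.
Proof.
move=> lt_i x x_in /=; apply: (@mem_flatten_nth _ _ i); first by rewrite size_map.
by rewrite (nth_map t0).
Qed.

Lemma uniq_vars_nth f (ts : seq (term S)) t0 i :
  uniq (vars (App f ts)) -> i < size ts -> uniq (vars (nth t0 ts i)).
Proof.
move=> /= + lt_i; rewrite -(cat_take_drop i (map _ _)) flatten_cat cat_uniq.
rewrite (drop_nth [::]) ?size_map // (nth_map t0) //= cat_uniq.
by case/and3P=> _ _ /and3P[].
Qed.

Lemma tsize_nth f (ts : seq (term S)) t0 i :
  i < size ts -> tsize (nth t0 ts i) < tsize (App f ts).
Proof.
move=> lt_i /=; rewrite ltnS sumn_nth size_map.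
apply: leq_trans (leq_sum_ord (nth 0 (map (@tsize S) ts)) lt_i).
by rewrite (nth_map t0).
Qed.

Lemma sort_subst s t :
  {in vars t, forall x, sort_of (s x) = vsort x} -> sort_of (subst s t) = sort_of t.
Proof. by case: t => //= x; apply; rewrite inE. Qed.

Lemma wf_subst_on s t :
  normalised_on (vars t) s -> wf_term t -> wf_term (subst s t).
Proof.
elim/term_nth_ind: t => [x|f ts IH] ns wft.
  by case: (ns x) => //=; rewrite inE.
have nsi i : i < size ts -> normalised_on (vars (nth (App f ts) ts i)) s.
  by move=> lt_i x x_in; apply: ns; apply: vars_nth x_in.
rewrite /=; apply/andP; split.
  have /= /andP[/eqP<- _] := wft; apply/eqP.
  apply: (@eq_from_nth _ (res_sort f)) => [|i]; rewrite !size_map // => lt_i.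
  rewrite (nth_map (App f ts)) ?size_map // !(nth_map (App f ts)) //.
  by apply: sort_subst => x /(nsi _ lt_i) [].
apply/(all_nthP (App f ts)) => i; rewrite size_map => lt_i.
rewrite (nth_map (App f ts)) //; apply: IH (nsi _ lt_i) _ => //.
exact: wf_nth wft lt_i.
Qed.

Lemma cterm_subst s t :
  normalised_on (vars t) s -> cterm t -> cterm (subst s t).
Proof.
elim/term_nth_ind: t => [x|f ts IH] ns /=.
  by case: (ns x) => [|_ _ /andP[_]] //; rewrite /= inE.
move=> /andP[-> /= cts]; apply/(all_nthP (App f ts)) => i.
rewrite size_map => lt_i; rewrite (nth_map (App f ts)) //; apply: IH => //.
  by move=> x x_in; apply: ns; apply: vars_nth x_in.
exact: all_nth cts lt_i.
Qed.

Lemma ground_subst s t : normalised_on (vars t) s -> ground (subst s t).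
Proof.
elim/term_nth_ind: t => [x|f ts IH] ns /=.
  by case: (ns x) => [|_ _ /andP[]] //; rewrite /= inE.
rewrite /ground /= /nilp size_flatten sumn_nth; apply/eqP/big1 => -[i /=].
rewrite size_map => lt_i _; rewrite (nth_map [::]) //.
move: lt_i; rewrite !size_map => lt_i.
rewrite (nth_map (App f ts)) ?size_map // (nth_map (App f ts)) //.
apply/eqP; apply: IH => // x x_in; apply: ns; exact: vars_nth x_in.
Qed.

Lemma cterm_plug (C : context S) t : cterm (plug C t) -> cterm t.
Proof.
elim: C => //= f pre C IH post /andP[_].
by rewrite all_cat /= => /and3P[_ /IH].
Qed.

(** Arguments of a basic term contain no defined symbol while a left-hand side has one at its root,
    so the redex is the whole term, and a normalised instance is ground. *)
Lemma basic_step_ground (R : trs S) t u :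
  (forall l r, List.In (l, r) R -> basic l) ->
  basic t -> step R t u -> ground t.
Proof.
move=> bR bt [C [l [r [s [inR ns def_t _]]]]]; subst t.
case: C bt => [_|f pre C post /= /andP[_]]; first exact: ground_subst.
rewrite all_cat /= => /and3P[_ /cterm_plug + _].
by move: (bR _ _ inR); case: l {inR ns} => //= g ls /andP[->].
Qed.

Lemma fresh_vars (X : seq (var S)) (bs : seq (bsort S)) :
  exists xs, [/\ uniq xs, map (@vsort S) xs = bs & ~~ has (mem xs) X].
Proof.
pose N := (\max_(x <- X) x.2).+1.
exists (zip bs (iota N (size bs))); split.
- apply: (@map_uniq _ _ snd); rewrite -/(unzip2 _) unzip2_zip ?size_iota //.
  exact: iota_uniq.
- by rewrite -/(unzip1 _) unzip1_zip ?size_iota.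
- apply/hasPn => x xX; apply/negP => /= x_in.
  have: x.2 \in iota N (size bs).
    rewrite -(@unzip2_zip _ _ bs (iota N (size bs))) ?size_iota //.
    exact: map_f.
  rewrite mem_iota /N ltnNge (leq_bigmax_seq _ xX) //.
Qed.

End Terms.

(** * Annotations *)

Lemma nth_ann_add u v i : nth 0 (ann_add u v) i = nth 0 u i + nth 0 v i.
Proof.
rewrite /ann_add; case: (ltnP i (maxn (size u) (size v))) => lt_i.
  by rewrite nth_mkseq.
rewrite nth_default ?size_mkseq //.
by move: lt_i; rewrite geq_max => /andP[? ?]; rewrite !nth_default.
Qed.

(** Turns the order on annotations into sums, so that additivity yields monotonicity. *)
Definition ann_sub (u v : annot) : annot :=
  mkseq (fun i => nth 0 u i - nth 0 v i) (size u).

Lemma ann_subK u v : ann_le v u -> ann_eq (ann_add v (ann_sub u v)) u.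
Proof.
move=> le_vu i; rewrite nth_ann_add /ann_sub.
case: (ltnP i (size u)) => lt_i; first by rewrite nth_mkseq // subnKC.
have := le_vu i; rewrite (@nth_default _ 0 u i) // leqn0 => /eqP->.
by rewrite nth_default ?size_mkseq.
Qed.

Lemma ann_le_refl u : ann_le u u.
Proof. by move=> i. Qed.

Lemma ann_le_trans v u w : ann_le u v -> ann_le v w -> ann_le u w.
Proof. by move=> uv vw i; apply: leq_trans (uv i) (vw i). Qed.

(** * Costs of annotated terms *)

Section Cost.
Variables (S : signature) (F : asig S).
Hypothesis hF : annotated_signature F.
Implicit Types (t u l r : term S) (s : var S -> term S) (f : fsym S).
Implicit Types (v w : annot) (G : tctx S).

Definition decl_arg f v i : annot := nth [::] (dargs (F f v)) i.

Lemma size_dargs f v : size (dargs (F f v)) = size (arg_sorts f).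
Proof. exact: asig_arity. Qed.

Lemma decl_arg_add f v w i j : ~~ defined f ->
  nth 0 (decl_arg f (ann_add v w) i) j
    = nth 0 (decl_arg f v i) j + nth 0 (decl_arg f w i) j.
Proof.
move=> cf; case: (asig_add hF v w cf) => _ -> _; rewrite /= /decl_arg.
have szE : size (dargs (F f v)) = size (dargs (F f w)) by rewrite !size_dargs.
case: (ltnP i (size (dargs (F f v)))) => lt_i.
  rewrite (nth_map ([::], [::])) ?size_zip -?szE ?minnn //.
  by rewrite nth_zip //= nth_ann_add.
by rewrite !(@nth_default _ [::] _ i) ?size_map ?size_zip -?szE ?minnn ?nth_nil.
Qed.

Lemma dcost_add f v w : ~~ defined f ->
  dcost (F f (ann_add v w)) = dcost (F f v) + dcost (F f w).
Proof. by move=> cf; case: (asig_add hF v w cf). Qed.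

(** The zero vector is its own multiple by 0, so its declaration is, up to padding, 0 times
    itself. *)
Lemma decl_zeros f n : ~~ defined f ->
  (forall i j, nth 0 (decl_arg f (nseq n 0) i) j = 0) /\
  dcost (F f (nseq n 0)) = 0.
Proof.
move=> cf; have := asig_scale hF (nseq n 0) 0 cf.
have -> : ann_scale 0 (nseq n 0) = nseq n 0 by rewrite /ann_scale map_nseq.
case=> _ argE ->; split=> [i j|]; last by rewrite /= mul0n.
rewrite argE /=; case: (ltnP i (size (dargs (F f (nseq n 0))))) => lt_i.
  rewrite (nth_map [::]) // /ann_scale.
  set a := nth _ _ i; case: (ltnP j (size a)) => lt_j.
    by rewrite (nth_map 0).
  by rewrite nth_default ?size_map.
by rewrite (@nth_default _ [::]) ?size_map // nth_nil.
Qed.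

(* [F f] is a function on lists, so its compatibility with padding by zeros is
   not built in: it comes from additivity, since the zero vectors have the zero
   declaration by scaling. *)
Lemma decl_congr f v w : ~~ defined f -> ann_eq v w ->
  (forall i j, nth 0 (decl_arg f v i) j = nth 0 (decl_arg f w i) j) /\
  dcost (F f v) = dcost (F f w).
Proof.
move=> cf vw.
(* Adding to each a zero vector of the other's length makes the two equal as lists, not merely up to
   padding. *)
have padE : ann_add v (nseq (size w) 0) = ann_add w (nseq (size v) 0).
  rewrite /ann_add !size_nseq maxnC; apply: eq_mkseq => i.
  by rewrite !nth_nseq !if_same vw.
have [zw cw] := decl_zeros (size w) cf; have [zv cv] := decl_zeros (size v) cf.
split=> [i j|].
  have := decl_arg_add v (nseq (size w) 0) i j cf.
  by rewrite padE decl_arg_add // zw zv !addn0.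
have := dcost_add v (nseq (size w) 0) cf.
by rewrite padE dcost_add // cw cv !addn0.
Qed.

Lemma decl_mono f v w : ~~ defined f -> ann_le v w ->
  (forall i, ann_le (decl_arg f v i) (decl_arg f w i)) /\
  dcost (F f v) <= dcost (F f w).
Proof.
move=> cf /ann_subK /(decl_congr cf)[argE <-].
split=> [i j|]; first by rewrite -argE decl_arg_add // leq_addr.
by rewrite dcost_add // leq_addr.
Qed.

(** * The interpretation and its cheapest variant *)

Definition tcost t v : nat := interp F t (sort_of t, v).

Lemma interpE t A : interp F t A = tcost t A.2.
Proof. by case: t. Qed.

Lemma tcostE f ts v t0 : size ts = size (arg_sorts f) ->
  tcost (App f ts) v
    = dcost (F f v) + \sum_(i < size ts) tcost (nth t0 ts i) (decl_arg f v i).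
Proof.
move=> szE; rewrite /tcost /= /gamma addnC /=; congr (_ + _).
rewrite sumnE big_map (big_nth (interp F t0, (res_sort f, [::]))) big_mkord.
rewrite !size_zip size_map size_dargs szE !minnn; apply: eq_bigr => i _.
rewrite nth_zip ?size_map ?size_zip ?size_dargs ?minnn //=.
rewrite (nth_map t0) ?szE // interpE nth_zip ?size_dargs //.
Qed.

(** Constructor declarations are closed under addition. The sum is taken up to padding because the
    argument annotations met in the induction agree only entrywise. *)
Lemma tcost_add t v1 v2 v : cterm t -> wf_term t ->
  ann_eq (ann_add v1 v2) v -> tcost t v1 + tcost t v2 = tcost t v.
Proof.
elim/term_nth_ind: t v1 v2 v => [//|f ts IH] v1 v2 v /= /andP[cf cts] wft vE.
have szE := wf_size wft; rewrite !(tcostE _ (App f ts)) //.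
have [argE <-] := decl_congr cf vE.
rewrite dcost_add // addnACA -big_split /=; congr (_ + _).
apply: eq_bigr => i _; apply: IH => //; first exact: all_nth cts _.
  exact: wf_nth wft _.
by move=> j; rewrite nth_ann_add -argE decl_arg_add.
Qed.

Lemma tcost_mono t v w : cterm t -> wf_term t ->
  ann_le v w -> tcost t v <= tcost t w.
Proof.
by move=> ct wft /ann_subK /(tcost_add ct wft) <-; apply: leq_addr.
Qed.

(* The least [n] with [cost_le t v n] is the variant of the interpretation that
   picks at every symbol the cheapest declaration whose result annotation is
   above the required one. *)
Inductive cost_le : term S -> annot -> nat -> Prop :=
  | cost_le_var x v n : cost_le (Var x) v n
  | cost_le_app f ts v w ns n :
      ann_le v w -> size ts = size (arg_sorts f) -> size ns = size ts ->
      (forall i, i < size ts ->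
         cost_le (nth (App f ts) ts i) (decl_arg f w i) (nth 0 ns i)) ->
      dcost (F f w) + sumn ns <= n ->
      cost_le (App f ts) v n.

Lemma cost_le_weaken t v n w m :
  cost_le t v n -> ann_le w v -> n <= m -> cost_le t w m.
Proof.
case=> [x {}v {}n|f ts {}v v' ns {}n vv' szE szn cts le_n] wv le_nm.
  exact: cost_le_var.
apply: cost_le_app szE szn cts (leq_trans le_n le_nm).
exact: ann_le_trans wv vv'.
Qed.

Lemma cost_le_appN f ts v w n (m : nat -> nat) t0 :
  ann_le v w -> size ts = size (arg_sorts f) ->
  (forall i, i < size ts -> cost_le (nth t0 ts i) (decl_arg f w i) (m i)) ->
  dcost (F f w) + \sum_(i < size ts) m i <= n ->
  cost_le (App f ts) v n.
Proof.
move=> vw szE cts le_n; apply: (cost_le_app (ns := mkseq m (size ts)) vw szE).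
- by rewrite size_mkseq.
- by move=> i lt_i; rewrite nth_mkseq // (set_nth_default t0) //; apply: cts.
rewrite sumn_nth size_mkseq; under eq_bigr do rewrite nth_mkseq //.
by [].
Qed.

Lemma cost_le_tcost t v : wf_term t -> cost_le t v (tcost t v).
Proof.
elim/term_nth_ind: t v => [x|f ts IH] v wft; first exact: cost_le_var.
have szE := wf_size wft; rewrite (tcostE _ (App f ts)) //.
apply: (cost_le_appN (t0 := App f ts)
  (m := fun i => tcost (nth (App f ts) ts i) (decl_arg f v i))
  (ann_le_refl v) szE _ (leqnn _)) => i lt_i.
by apply: IH => //; apply: wf_nth wft lt_i.
Qed.

(** Where [tcost] is monotone, replacing the chosen [w] by [v] at each symbol never raises the cost.
    [P] stands for the constructor terms, or for all well-formed terms when [F] is monotone. *)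
Lemma tcost_le (P : pred (term S)) t v n :
  (forall f ts t0 i, i < size ts -> P (App f ts) -> P (nth t0 ts i)) ->
  (forall t v w, P t -> ann_le v w -> tcost t v <= tcost t w) ->
  P t -> cost_le t v n -> tcost t v <= n.
Proof.
move=> Psub Pmono Pt ct.
elim: ct Pt => [//|f ts {}v w ns {}n vw szE szn _ IH le_n] Pt.
apply: leq_trans (Pmono _ _ _ Pt vw) _; apply: leq_trans le_n.
rewrite (tcostE _ (App f ts)) // leq_add2l sumn_nth szn.
by apply: leq_sum => i _; apply: IH => //; apply: Psub Pt.
Qed.

Lemma tcost_le_value t v n :
  cterm t -> wf_term t -> cost_le t v n -> tcost t v <= n.
Proof.
move=> ct wft; apply: (@tcost_le (fun t => cterm t && wf_term t)).
- move=> f ts t0 i lt_i /andP[/= /andP[_ cts] wfts].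
  by rewrite (all_nth _ cts) // (wf_nth _ wfts).
- by move=> {}t {}v w /andP[{}ct {}wft]; apply: tcost_mono.
- by rewrite ct.
Qed.

Lemma tcost_le_monotone t v n :
  subtype_monotone F -> wf_term t -> cost_le t v n -> tcost t v <= n.
Proof.
move=> mF; apply: (@tcost_le (@wf_term S)) => [f ts t0 i lt_i wft|{n v}t].
  exact: wf_nth wft lt_i.
elim/term_nth_ind: t => [//|f ts IH] v w wft vw.
have szE := wf_size wft; rewrite !(tcostE _ (App f ts)) //.
have [argle costle] : (forall i, ann_le (decl_arg f v i) (decl_arg f w i)) /\
                      dcost (F f v) <= dcost (F f w).
  by have [df|cf] := boolP (defined f); [apply: mF | apply: decl_mono].
apply: leq_add => //; apply: leq_sum => i _; apply: IH => //.
exact: wf_nth wft _.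
Qed.

(** * Inversion and soundness of typing *)

Lemma mem_share (x y z w : var S) A A1 A2 B G :
  uniq [:: x, y & dom G] -> sharing A A1 A2 ->
  (w, B) \in [:: (x, A1), (y, A2) & G] ->
  exists2 B', (if (w == x) || (w == y) then z else w, B') \in (z, A) :: G
            & ann_le B.2 B'.2.
Proof.
move=> /= /and3P[]; rewrite inE negb_or => /andP[_ xG] yG _ [_ _ sumE].
have le1 : ann_le A1.2 A.2 by move=> i; rewrite -sumE nth_ann_add leq_addr.
have le2 : ann_le A2.2 A.2 by move=> i; rewrite -sumE nth_ann_add leq_addl.
rewrite !inE => /or3P[/eqP[-> ->]|/eqP[-> ->]|wG].
- by exists A; rewrite // eqxx inE eqxx.
- by exists A; rewrite // eqxx orbT inE eqxx.
have wdom : w \in dom G by apply: (map_f fst wG).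
exists B => //; have /negPf-> : w != x by apply: contraNneq xG => <-.
have /negPf-> : w != y by apply: contraNneq yG => <-.
by rewrite inE wG orbT.
Qed.

(** Read towards the conclusion, the structural rules only raise the annotation of a binding or
    lower that of the result. *)
Lemma typing_var_inv G p t C : typing F G p t C ->
  forall x, t = Var x -> exists2 A, (x, A) \in G & ann_le C.2 A.2.
Proof.
elim=> {G p t C}; try by [].
- move=> G x A p t C _ _ _ IH x' /IH[B xB le_B].
  by exists B => //; rewrite inE xB orbT.
- move=> G x y z A A1 A2 p [w|//] C uq _ _ sh _ IH _ [<-].
  have [B wB le_B] := IH w erefl.
  have [B' wB' le_B'] := mem_share z uq sh wB.
  by exists B' => //; apply: ann_le_trans le_B le_B'.
- move=> G x A B p t C [_ le_BA] _ IH x' /IH[D].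
  rewrite inE => /predU1P[[-> ->] le_D|xD le_D].
    by exists A; rewrite ?inE ?eqxx //; apply: ann_le_trans le_D le_BA.
  by exists D; rewrite // inE xD orbT.
- by move=> x A _ x' [<-]; exists A; rewrite ?inE.
- move=> G p t D C _ IH [_ le_CD] x /IH[A xA le_A].
  by exists A => //; apply: ann_le_trans le_CD le_A.
- move=> G G' p t C GG' _ IH x /IH[A xA le_A].
  by exists A; rewrite // -(perm_mem GG').
Qed.

Lemma map_subst_var (ren : var S -> var S) ts xs :
  map (subst (fun x => Var (ren x))) ts = map Var xs ->
  exists2 xs0, ts = map Var xs0 & xs = map ren xs0.
Proof.
elim: ts xs => [|t ts IH] [|x xs] //=; first by exists [::].
case: t => [w [<-]|//] /IH [xs0 -> ->].
by exists (w :: xs0).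
Qed.

Lemma map_Var_inj : injective (map (@Var S)).
Proof. by apply: inj_map => x y []. Qed.

(* A declared symbol applied to variables can only be typed through one of its
   declarations. This makes rule (3) compositional: its premise on
   [f(x_1, .., x_n)] cannot use sharing in an essential way, so the variables
   may stand for terms that are not values. *)
Lemma typing_app_inv G p t C : typing F G p t C ->
  forall f xs, t = App f (map Var xs) ->
  exists w, [/\ ann_le C.2 w, dcost (F f w) <= p, size xs = size (arg_sorts f)
    & forall x0 i, i < size xs ->
        exists2 A, (nth x0 xs i, A) \in G & ann_le (decl_arg f w i) A.2].
Proof.
elim=> {G p t C}; try by [].
- move=> f xs v uq srt g ys [<- /map_Var_inj <-].
  have szE : size xs = size (arg_sorts f) by rewrite -srt size_map.
  exists v; split=> // x0 i lt_i.
  exists (nth (res_sort f) (arg_sorts f) i, decl_arg f v i) => //.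
  have szA : size (arg_types F f v) = size xs.
    by rewrite size_zip size_dargs minnn.
  apply/(nthP (x0, (res_sort f, [::]))); exists i.
    by rewrite size_zip szA minnn.
  by rewrite nth_zip // nth_zip ?size_dargs.
- move=> G p p' t C _ IH le_p f xs /IH[w [? le_c ? ?]].
  by exists w; split=> //; apply: leq_trans le_c le_p.
- move=> f xs As C p0 Gs ps ts szx szA szG szp uq _ IH typ _ g ys [<- tsE].
  have [w [le_w le_c szE args]] := IH _ _ erefl.
  have szy : size ys = size ts by rewrite tsE size_map.
  exists w; split=> //; first exact: leq_trans le_c (leq_addr _ _).
    by rewrite szy -szx.
  move=> x0 i; rewrite szy => lt_i.
  have [|A inA le_A] := args x0 i; first by rewrite szx.
  move: uq; rewrite cat_uniq => /andP[uqx _].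
  (* The [xs] are distinct by freshness, so the type bound to the i-th one can only be the i-th of
     [As]. *)
  have AE : A = nth C As i.
    by apply: (mem_zip_nth C uqx _ _ inA); rewrite ?szx.
  have tiE : nth (App f ts) ts i = Var (nth x0 ys i).
    by rewrite tsE (nth_map x0) ?szy.
  have [B inB le_B] := typing_var_inv (typ i lt_i) tiE.
  exists B; first by apply: mem_flatten_nth inB; rewrite szG.
  by apply: ann_le_trans le_B; rewrite -AE.
- move=> G x A p t C _ _ _ IH f xs /IH[w [? ? ? args]].
  exists w; split=> // x0 i /(args x0)[B inB le_B].
  by exists B => //; rewrite inE inB orbT.
- move=> G x y z A A1 A2 p [//|g ts] C uq _ _ sh _ IH f xs [<-].
  move=> /map_subst_var[xs0 tsE ->].
  have [w [? ? szE args]] := IH g xs0 (congr1 _ tsE).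
  exists w; rewrite size_map; split=> // x0 i lt_i.
  have [B inB le_B] := args x0 i lt_i.
  have [B' inB' le_B'] := mem_share z uq sh inB.
  by exists B'; [rewrite (nth_map x0) | apply: ann_le_trans le_B le_B'].
- move=> G x A B p t C [_ le_BA] _ IH f xs /IH[w [? ? ? args]].
  exists w; split=> // x0 i /(args x0)[D].
  rewrite inE => /predU1P[[-> ->] le_D|xD le_D].
    by exists A; rewrite ?inE ?eqxx //; apply: ann_le_trans le_D le_BA.
  by exists D; rewrite // inE xD orbT.
- move=> G p t D C _ IH [_ le_CD] f xs /IH[w [le_w ? ? ?]].
  by exists w; split=> //; apply: ann_le_trans le_CD le_w.
- move=> G G' p t C GG' _ IH f xs /IH[w [? ? ? args]].
  exists w; split=> // x0 i /(args x0)[A inA le_A].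
  by exists A; rewrite // -(perm_mem GG').
Qed.

(** The potential of the context, in the sense of amortised analysis. *)
Definition ctx_cost s G : nat := \sum_(b <- G) tcost (s b.1) b.2.2.

Lemma ctx_cost_cons s x A G :
  ctx_cost s ((x, A) :: G) = tcost (s x) A.2 + ctx_cost s G.
Proof. exact: big_cons. Qed.

Lemma ctx_cost_eq s1 s2 G :
  {in dom G, s1 =1 s2} -> ctx_cost s1 G = ctx_cost s2 G.
Proof. by move=> eqs; apply: eq_big_seq => b b_in; rewrite eqs ?map_f. Qed.

Lemma subst_comp s s' t :
  subst s (subst s' t) = subst (fun x => subst s (s' x)) t.
Proof.
elim/term_nth_ind: t => [//|f ts IH] /=; congr App; rewrite -map_comp.
apply: (@eq_from_nth _ (App f ts)) => [|i]; rewrite !size_map // => lt_i.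
by rewrite !(nth_map (App f ts)) //; apply: IH.
Qed.

(** The bound concerns [cost_le] because result subtyping may lower the annotation at a defined
    symbol, where [tcost] need not decrease. The induction generalises [s], which sharing alters. *)
Lemma typing_sound G p t C s : typing F G p t C ->
  {in dom G, forall x, cterm (s x) && wf_term (s x)} ->
  cost_le (subst s t) C.2 (p + ctx_cost s G).
Proof.
move=> typ; elim: typ s => {G p t C}.
- move=> f xs v uq srt s val.
  have szE : size xs = size (arg_sorts f) by rewrite -srt size_map.
  have szA : size xs = size (arg_types F f v).
    by rewrite size_zip size_dargs minnn.
  pose x0 : var S := (res_sort f, 0).
  apply: (cost_le_appN (t0 := s x0)
    (m := fun i => tcost (s (nth x0 xs i)) (decl_arg f v i))
    (ann_le_refl v)) => [|i|].
  + by rewrite !size_map.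
  + rewrite !size_map => lt_i; rewrite -map_comp (nth_map x0) //=.
    apply: cost_le_tcost; suff: nth x0 xs i \in dom (zip xs (arg_types F f v)).
      by case/val/andP.
    by rewrite /dom unzip1_zip ?szA ?leqnn //; apply: mem_nth.
  + rewrite !size_map /ctx_cost (big_nth (x0, (res_sort f, [::]))) big_mkord.
    rewrite size_zip -szA minnn leq_add2l; apply/eq_leq/eq_bigr => i _.
    by rewrite !nth_zip ?size_dargs.
- move=> G p p' t C _ IH le_p s /IH /cost_le_weaken; apply=> //.
  by rewrite leq_add2r.
- move=> f xs As C p0 Gs ps ts szx szA szG szp uq typf _ _ IH s val.
  have [w [le_w le_c szE args]] := typing_app_inv typf erefl.
  move: uq; rewrite cat_uniq => /andP[uqx _].
  pose x0 : var S := (res_sort f, 0).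
  apply: (cost_le_appN (t0 := subst s (App f ts)) (w := w)
    (m := fun i => nth 0 ps i + ctx_cost s (nth [::] Gs i)) le_w) => [|i|].
  + by rewrite size_map -szx.
  + rewrite size_map => lt_i; rewrite (nth_map (App f ts)) //.
    have [|A inA le_A] := args x0 i; first by rewrite szx.
    have AE : A = nth C As i.
      by apply: (mem_zip_nth C uqx _ _ inA); rewrite ?szx.
    rewrite AE in le_A; apply: cost_le_weaken le_A (leqnn _).
    apply: IH => // x /mapP[b b_in ->]; apply/val/map_f.
    by apply: mem_flatten_nth b_in; rewrite szG.
  + rewrite size_map big_split /= addnA leq_add //.
      by rewrite sumn_nth szp leq_add2r.
    by rewrite /ctx_cost sum_flatten szG.
- move=> G x A p t C _ _ _ IH s val.
  apply: cost_le_weaken (IH s _) (ann_le_refl _) _ => [y y_in|].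
    by apply: val; rewrite inE y_in orbT.
  by rewrite ctx_cost_cons leq_add2l leq_addl.
- move=> G x y z A A1 A2 p t C uq zG _ [_ _ sumE] _ IH s val.
  (* Both copies receive the term [s z]; additivity then splits the potential of [z] exactly. *)
  pose s' (w : var S) := s (if (w == x) || (w == y) then z else w).
  have -> : subst s (identify x y z t) = subst s' t.
    by rewrite /identify subst_comp.
  have [s'x s'y] : s' x = s z /\ s' y = s z by rewrite /s' !eqxx orbT.
  have s'G : {in dom G, s' =1 s}.
    move: uq => /= /and3P[]; rewrite inE negb_or => /andP[_ xG] yG _ w wG.
    rewrite /s'; case: eqVneq wG xG => [-> -> //|_ wG _].
    by case: eqVneq wG yG => [-> -> //|].
  have /andP[cz wfz] : cterm (s z) && wf_term (s z).
    by apply: val; rewrite inE eqxx.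
  apply: cost_le_weaken (IH s' _) (ann_le_refl _) _ => [w|].
    rewrite !inE => /or3P[/eqP->|/eqP->|wG]; rewrite ?s'x ?s'y ?cz ?wfz //.
    by rewrite s'G //; apply: val; rewrite inE wG orbT.
  rewrite !ctx_cost_cons s'x s'y (ctx_cost_eq s'G) addnA.
  by rewrite -(tcost_add cz wfz sumE) !addnA.
- move=> G x A B p t C [_ le_BA] _ IH s val.
  apply: cost_le_weaken (IH s val) (ann_le_refl _) _.
  have /andP[cx wfx] : cterm (s x) && wf_term (s x).
    by apply: val; rewrite inE eqxx.
  by rewrite !ctx_cost_cons leq_add2l leq_add2r tcost_mono.
- move=> x A _ s val /=; rewrite add0n ctx_cost_cons /ctx_cost big_nil addn0.
  by apply: cost_le_tcost; have /andP[] := val x (mem_head _ _).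
- move=> G p t D C _ IH [_ le_CD] s val.
  exact: cost_le_weaken (IH s val) le_CD (leqnn _).
- move=> G G' p t C GG' _ IH s val.
  rewrite /ctx_cost -(perm_big _ GG'); apply: IH => x x_in; apply: val.
  by rewrite -(perm_mem (perm_map fst GG')).
Qed.

(** * Typing linear patterns without loss of potential *)

Definition well_sorted G : Prop := {in G, forall b, b.2.1 = vsort b.1}.

Lemma typing_weaken H G p t C :
  uniq (dom (H ++ G)) -> well_sorted H -> typing F G p t C ->
  typing F (H ++ G) p t C.
Proof.
elim: H => [//|[x A] H IH] /= /andP[xHG uq] ws typ.
apply: ty_weak => //; first exact: (ws (x, A) (mem_head _ _)).
by apply: IH => // b b_in; apply: ws; rewrite inE b_in orbT.
Qed.

(** [well_typed] wants each pattern typed in the context of the whole left-hand side; weakening and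
    exchange supply the blocks of the other patterns. *)
Lemma typing_flatten (Gs : seq (tctx S)) i p t C :
  uniq (dom (flatten Gs)) -> well_sorted (flatten Gs) -> i < size Gs ->
  typing F (nth [::] Gs i) p t C -> typing F (flatten Gs) p t C.
Proof.
move=> uq ws lt_i typ.
pose H := flatten (take i Gs) ++ flatten (drop i.+1 Gs).
have perm_HG : perm_eq (H ++ nth [::] Gs i) (flatten Gs).
  rewrite -[in X in perm_eq _ X](cat_take_drop i Gs) (drop_nth [::] lt_i).
  by rewrite flatten_cat /= /H -catA perm_cat2l perm_catC.
apply: ty_exch (perm_HG) _; apply: typing_weaken typ.
  by rewrite (perm_uniq (perm_map fst perm_HG)).
move=> b b_in; apply: ws; rewrite -(perm_mem perm_HG).
by rewrite mem_cat b_in.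
Qed.

(** The last clause says that no potential is lost, for all substitutions at once. Listing the
    variables in order of occurrence lets contexts be concatenated. *)
Definition exact_typing t A G k : Prop :=
  [/\ dom G = vars t, well_sorted G, typing F G k t A
    & forall s, k + ctx_cost s G = tcost (subst s t) A.2].

Lemma nth_arg_types C f v i : i < size (arg_sorts f) ->
  nth C (arg_types F f v) i = (nth C.1 (arg_sorts f) i, decl_arg f v i).
Proof.
move=> lt_i; rewrite /arg_types (set_nth_default (C.1, [::])).
  by rewrite nth_zip ?size_dargs.
by rewrite size_zip size_dargs minnn.
Qed.

(** With [f] arbitrary, this serves both the inductive step on patterns and the left-hand side of a
    rule. *)
Lemma exact_typing_args f ts v C : wf_term (App f ts) ->
  (forall i, i < size ts -> exists G k,
     exact_typing (nth (App f ts) ts i) (nth C (arg_types F f v) i) G k) ->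
  exists Gs ks, [/\ size Gs = size ts, size ks = size ts,
    dom (flatten Gs) = vars (App f ts), well_sorted (flatten Gs)
    & (forall i, i < size ts ->
        typing F (nth [::] Gs i) (nth 0 ks i) (nth (App f ts) ts i)
          (nth C (arg_types F f v) i)) /\
      forall s, sumn ks + ctx_cost s (flatten Gs)
        = \sum_(i < size ts)
            tcost (subst s (nth (App f ts) ts i)) (decl_arg f v i)].
Proof.
move=> wft ex.
have {ex} /choice[g gP] : forall i, exists Gk : tctx S * nat, i < size ts ->
    exact_typing (nth (App f ts) ts i) (nth C (arg_types F f v) i) Gk.1 Gk.2.
  move=> i; case: (ltnP i (size ts)) => [/ex[G [k Gk]]|_].
    by exists (G, k).
  by exists ([::], 0).
exists (mkseq (fun i => (g i).1) (size ts)), (mkseq (fun i => (g i).2) (size ts)).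
split; rewrite ?size_mkseq //.
- rewrite /dom /unzip1 map_flatten /=; congr flatten.
  apply: (@eq_from_nth _ [::]) => [|i]; rewrite !size_map ?size_iota // => lt_i.
  rewrite (nth_map [::]) ?size_mkseq // nth_mkseq // (nth_map (App f ts)) //.
  by have [] := gP i lt_i.
- move=> b /flattenP[G /(nthP [::])[i]]; rewrite size_mkseq => lt_i.
  by rewrite nth_mkseq // => <-; have [_ ws _ _] := gP i lt_i; apply: ws.
split=> [i lt_i|s]; first by rewrite !nth_mkseq //; have [] := gP i lt_i.
rewrite /ctx_cost sum_flatten sumn_nth !size_mkseq -big_split.
apply: eq_bigr => i _; rewrite !nth_mkseq //=.
have [_ _ _ ->] := gP i (ltn_ord i).
by rewrite nth_arg_types // -(wf_size wft).
Qed.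

(** Linearity makes the contexts of the arguments disjoint, so [ty_comp] joins them without any
    sharing. *)
Lemma cterm_exact_typing t A :
  cterm t -> wf_term t -> uniq (vars t) -> sort_of t = A.1 ->
  exists G k, exact_typing t A G k.
Proof.
elim/term_nth_ind: t A => [x|f ts IH] [b v] ct wft uq /= srt.
  exists [:: (x, (b, v))], 0; split=> //.
  - by move=> c; rewrite inE => /eqP->.
  - exact: ty_var.
  - by move=> s; rewrite /ctx_cost big_seq1.
subst b; have szE := wf_size wft.
have [i lt_i|Gs [ks [szG szk domE ws [typ costE]]]] :=
    @exact_typing_args f ts v (res_sort f, v) wft.
  apply: IH => //.
  - by move: ct => /= /andP[_ cts]; apply: all_nth cts lt_i.
  - exact: wf_nth wft lt_i.
  - exact: (@uniq_vars_nth S f ts _ i uq lt_i).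
  - by rewrite nth_arg_types -?szE //=; apply: sort_nth wft lt_i.
have [xs [uqx srt fresh]] := fresh_vars (dom (flatten Gs)) (arg_sorts f).
have szx : size xs = size ts by rewrite szE -srt size_map.
exists (flatten Gs), (dcost (F f v) + sumn ks); split=> //.
- apply: (ty_comp (xs := xs) (As := arg_types F f v)) => //.
  + by rewrite size_zip size_dargs minnn szE.
  + by rewrite cat_uniq uqx fresh domE.
  + exact: ty_decl.
- move=> s; rewrite -addnA costE /= (tcostE _ (App f (map (subst s) ts))).
    rewrite size_map; congr (_ + _); apply: eq_bigr => i _.
    by rewrite (nth_map (App f ts)).
  by rewrite size_map.
Qed.

(** * Strict decrease along rewrite steps *)

Variable R : trs S.
Hypothesis hR : constructor_trs R.
Hypothesis hwt : well_typed F R.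

Lemma cost_le_rule l r s v n :
  List.In (l, r) R -> normalised_on (vars l) s ->
  cost_le (subst s l) v n -> exists2 n', n' < n & cost_le (subst s r) v n'.
Proof.
move=> inR ns.
have [bl wfl _ _ _] := trs_rules hR inR; have uql := trs_left_linear hR inR.
case: l inR ns bl wfl uql => [//|f ls] inR ns /= /andP[_ cls] wfl uql.
have szE := wf_size wfl.
set t := App f _ => ct; case: {-1}t _ _ / ct (erefl t) => //.
move=> g ts v' w ms m le_w szts szm cts le_m [gE tsE]; subst g ts.
rewrite size_map in szm cts.
have nsi i : i < size ls -> normalised_on (vars (nth (App f ls) ls i)) s.
  by move=> lt_i x x_in; apply: ns; apply: vars_nth x_in.
(* The patterns are typed for the declaration at [w], which pays for [f] in the given cost; the
   result is lowered from [w] at the end. *)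
have [i lt_i|Gs [ks [szG szk domE ws [typ costE]]]] :=
    @exact_typing_args f ls w (res_sort f, w) wfl.
  apply: cterm_exact_typing.
  - exact: all_nth cls lt_i.
  - exact: wf_nth wfl lt_i.
  - exact: (@uniq_vars_nth S f ls _ i uql lt_i).
  - by rewrite nth_arg_types -?szE //=; apply: sort_nth wfl lt_i.
have [||i lt_i|q qE typr] := hwt inR (v := w) (G := flatten Gs) (ks := ks).
- by rewrite undup_id.
- by [].
- rewrite (set_nth_default (App f ls)) //.
  by apply: typing_flatten (typ i lt_i) => //; rewrite ?domE ?szG.
exists (q + ctx_cost s (flatten Gs)); last first.
  apply: cost_le_weaken (typing_sound typr _) le_w (leqnn _) => x.
  by rewrite domE => /ns[-> _ /andP[_ ->]].
(* The successor in [qE] is the unit that the rule consumes, hence the strict decrease. *)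
rewrite -addSn qE -addnA costE; apply: leq_trans le_m.
rewrite leq_add2l sumn_nth szm; apply: leq_sum => i _.
have lt_i := ltn_ord i.
(* Instances of patterns are constructor terms, on which no choice of declarations beats [tcost]. *)
apply: tcost_le_value.
- by apply: cterm_subst (nsi _ lt_i) _; apply: all_nth cls lt_i.
- by apply: wf_subst_on (nsi _ lt_i) _; apply: wf_nth wfl lt_i.
by have := cts i lt_i; rewrite (nth_map (App f ls)).
Qed.

(** The declarations along the context are kept. They determine the annotation at the hole, so the
    hypothesis ranges over all annotations. *)
Lemma cost_le_plug (C : context S) t u :
  (forall v n, cost_le t v n -> exists2 n', n' < n & cost_le u v n') ->
  forall v n, cost_le (plug C t) v n ->
    exists2 n', n' < n & cost_le (plug C u) v n'.
Proof.
move=> dec; elim: C => [//|f pre C IH post] v n /=.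
set t' := App f _ => ct; case: {-1}t' _ _ / ct (erefl t') => //.
move=> g ts {}v w ms {}n le_w szts szm cts le_n [gE tsE]; subst g ts.
rewrite size_cat /= in szts szm cts.
have [|m' lt_m' cu] := IH (decl_arg f w (size pre)) (nth 0 ms (size pre)).
  have := cts (size pre); rewrite nth_cat ltnn subnn /=; apply.
  by rewrite addnS ltnS leq_addr.
pose N := size pre + (size post).+1.
have lt_pre : size pre < N by rewrite /N addnS ltnS leq_addr.
pose m i := if i == size pre then m' else nth 0 ms i.
exists (dcost (F f w) + \sum_(i < N) m i).
  apply: leq_trans le_n; rewrite ltn_add2l sumn_nth szm.
  rewrite (bigD1 (Ordinal lt_pre)) //= [in leqRHS](bigD1 (Ordinal lt_pre)) //=.
  rewrite /m eqxx -addSn leq_add //.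
  apply: leq_sum => i; rewrite -val_eqE /= => /negPf->.
  exact: leqnn.
apply: (cost_le_appN (m := m) (t0 := App f (pre ++ plug C t :: post)) le_w).
- by rewrite size_cat.
- move=> i; rewrite size_cat /= => lt_i; rewrite /m.
  case: eqVneq => [->|ne_i]; first by rewrite nth_cat ltnn subnn.
  by rewrite (nth_cat_cons _ _ (plug C t)) //; apply: cts.
- by rewrite size_cat.
Qed.

Lemma cost_le_step t u v n : step R t u -> cost_le t v n ->
  exists2 n', n' < n & cost_le u v n'.
Proof.
case=> C [l [r [s [inR ns -> ->]]]]; apply: cost_le_plug => {}v {}n.
exact: cost_le_rule.
Qed.

Lemma derivation_le m t v n : derivation R m t -> cost_le t v n -> m <= n.
Proof.
move=> der; elim: der n => {m t} // m t u tu _ IH n /(cost_le_step tu)[n' lt_n'].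
by move/IH => le_m; apply: leq_ltn_trans lt_n'.
Qed.

Lemma rule_interp_gt l r A :
  subtype_monotone F -> List.In (l, r) R -> interp_gt F A l r.
Proof.
move=> mF inR s ns; rewrite !interpE.
have [_ wfl wfr _ _] := trs_rules hR inR.
have nsl : normalised_on (vars l) s.
  by move=> x x_in; apply: ns; rewrite mem_cat x_in.
have nsr : normalised_on (vars r) s.
  by move=> x x_in; apply: ns; rewrite mem_cat x_in orbT.
have [n' lt_n' cr] := cost_le_rule inR nsl (cost_le_tcost A.2 (wf_subst_on nsl wfl)).
apply: leq_ltn_trans lt_n'; apply: tcost_le_monotone cr => //.
exact: wf_subst_on.
Qed.

(** * Bounds on the runtime complexity *)

(** Variables may give infinitely many terms of one size, but they cost 0, and the symbols are
    finitely many and of fixed arity. *)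
Lemma tcost_bounded N v :
  exists M, forall t, wf_term t -> tsize t <= N -> tcost t v <= M.
Proof.
elim: N v => [|N /choice[B BP]] v; first by exists 0; case.
exists (\max_f (dcost (F f v) + \sum_(i < size (arg_sorts f)) B (decl_arg f v i))).
move=> [//|f ts] wft le_N; have szE := wf_size wft.
rewrite (tcostE _ (App f ts)) // szE.
apply: leq_trans (leq_bigmax f); rewrite leq_add2l; apply: leq_sum => i _.
have lt_i : i < size ts by rewrite szE.
apply: BP; first exact: wf_nth wft lt_i.
by rewrite -ltnS; apply: leq_trans le_N; apply: tsize_nth.
Qed.

(** Derivations do not depend on annotations, so a single one can be fixed; the empty one is
    taken. *)
Lemma basic_derivation_le m t : wf_term t -> basic t -> derivation R m t ->
  m <= if ground t then tcost t [::] else 0.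
Proof.
move=> wft bt der; case: ifPn => [_|ngt].
  exact: derivation_le der (cost_le_tcost _ wft).
case: der ngt bt {wft} => [//|{}m {}t u tu _ ngt bt]; case/negP: ngt.
by apply: (basic_step_ground _ _ tu) => // l r /(trs_rules hR)[].
Qed.

(** A uniform bound on all derivations makes both the heights and their maximum exist, as maxima of
    bounded sets. *)
Lemma rc_exists n : exists m, is_rc R n m.
Proof.
have [M MP] := tcost_bounded n [::].
have bnd t m : small_basic n t -> derivation R m t -> m <= M.
  case=> wft bt szt /(basic_derivation_le wft bt) /leq_trans; apply.
  by case: ifP => // _; apply: MP.
have dh t : small_basic n t -> exists d, is_dh R t d.
  move=> sbt; have [d ? ?] := bounded_has_max (deriv0 R t) (bnd t ^~ sbt).
  by exists d.
have [[t0 sbt0]|none] := pselect (exists t, small_basic n t); last first.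
  have {}none t : ~ small_basic n t by move=> sbt; apply: none; exists t.
  by exists 0; split=> [t /none|]; last by right.
have [d0 dh0] := dh _ sbt0.
have [||d [t [sbt dht]] maxd] := @bounded_has_max
    (fun d => exists t, small_basic n t /\ is_dh R t d) d0 M.
- by exists t0.
- by move=> d [t [sbt [der _]]]; apply: bnd sbt der.
exists d; split; last by left; exists t.
move=> u sbu; have [e dhe] := dh u sbu.
by exists e => //; apply: maxd; exists u.
Qed.

Lemma basic_derivation_bigO k : interp_bigO F k ->
  exists c, forall n t m, 0 < n -> small_basic n t -> derivation R m t ->
    m <= c * n ^ k.
Proof.
move=> bO.
have /choice[c /choice[n0 cn0]] : forall b : bsort S, exists c, exists n0,
    forall t, wf_term t -> ground t -> basic t -> sort_of t = b ->
      n0 <= tsize t -> tcost t [::] <= c * tsize t ^ k.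
  move=> b; have [c [n0 H]] := bO (b, [::]); exists c, n0 => t wft gt bt srt le_n.
  by have := H t wft gt bt srt le_n; rewrite interpE.
have [M MP] := tcost_bounded (\max_b n0 b) [::].
(* With one annotation and finitely many sorts, the constants of [interp_bigO] have a maximum. [M]
   covers terms below the thresholds and is absorbed because [n ^ k] is positive. *)
exists (M + \max_b c b) => n t m n_gt0 [wft bt szt].
move=> /(basic_derivation_le wft bt) /leq_trans; apply; case: ifP => // gt.
have nk_gt0 : 0 < n ^ k by rewrite expn_gt0 n_gt0.
rewrite mulnDl; case: (leqP (n0 (sort_of t)) (tsize t)) => le_n.
  apply: leq_trans (cn0 _ _ wft gt bt erefl le_n) _.
  apply: leq_trans (leq_addl _ _); apply: leq_mul; first exact: leq_bigmax.
  by case: (posnP k) => [->//|k_gt0]; rewrite leq_exp2r.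
apply: leq_trans (leq_addr _ _); apply: leq_trans (leq_pmulr _ nk_gt0).
apply: MP => //; apply: leq_trans (ltnW le_n) _; exact: leq_bigmax.
Qed.

End Cost.

Theorem theorem4 (S : signature) (R : trs S) (F : asig S)
    (hR : constructor_trs R) (hF : annotated_signature F)
    (hwt : well_typed F R) :
  (subtype_monotone F ->
   forall l r : term S, List.In (l, r) R ->
   forall A : atype S, A.1 = sort_of l -> interp_gt F A l r)
  /\
  (forall k : nat, interp_bigO F k ->
   exists rc : nat -> nat, (forall n : nat, is_rc R n (rc n)) /\ bigO rc k).
Proof.
split=> [mF l r inR A _|k bO]; first exact: (rule_interp_gt hF hR hwt A mF inR).
have /choice[rc rcP] := rc_exists hF hR hwt.
exists rc; split=> //.
have [c cP] := basic_derivation_bigO hF hR hwt bO.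
exists c, 1 => n n_gt0; have [_ [[t sbt [der _]]|[_ ->] //]] := rcP n.
exact: cP n_gt0 sbt der.
Qed.
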